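(* Let $N\geq 1$ be an integer. Then for all $0<t<\pi/2$, \[ L_N(t)<t\sec^2 t-\tan t-\sum_{j=1}^{N-1}\frac{2j\cdot 2^{2j+2}(2^{2j+2}-1)|B_{2j+2}|}{(2j+2)!}t^{2j+1}-\frac{N\cdot 2^{2N+4}t^{2N+1}}{\pi^{2N}(\pi^2-4t^2)}-\frac{2^{2N+6}t^{2N+3}}{\pi^{2N}(\pi^2-4t^2)^2}<M_N(t), \] where \[ L_N(t)=\frac{N\cdot 2^{2N+4}t^{2N+1}}{\pi^{2N+2}}\left\{\frac{(2^{2N+2}-1)\pi^{2N+2}|B_{2N+2}|}{2\cdot(2N+2)!}-1\right\}+\frac{2^{2N+6}t^{2N+3}}{\pi^{2N+4}}\left\{\frac{(2^{2N+4}-1)\pi^{2N+4}|B_{2N+4}|}{2\cdot(2N+4)!}-1\right\} \] and \[ M_N(t)=\frac{N\cdot 2^{2N+2}t^{2N+1}}{\pi^{2N+2}}\sum_{k=2}^{\infty}\frac{1}{(2k-1)^{2N}k(k-1)}+\frac{2^{2N+2}t^{2N+3}}{\pi^{2N+4}}\sum_{k=2}^{\infty}\frac{1}{(2k-1)^{2N}k^2(k-1)^2}. \]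
   Context: The Bernoulli numbers $B_n$ are defined by $\frac{t}{e^t-1}=\sum_{n=0}^\infty B_n\frac{t^n}{n!}$ for $|t|<2\pi$. An empty sum is understood to be zero. *)

(* Defs.v *)
From Stdlib Require Import Reals Lra Lia Factorial.
Export Reals Factorial.
Open Scope R_scope.

(* The Bernoulli numbers, characterised as in the paper by the generating
   function  t/(e^t-1) = sum_{n>=0} B_n t^n/n!  for 0 < |t| < 2*pi
   (at t = 0 the left-hand side is understood as its limit 1; excluding t = 0
   does not change which sequence is characterised). *)
Definition is_bernoulli (B : nat -> R) : Prop :=
  forall t : R, 0 < Rabs t < 2 * PI ->
    infinite_sum (fun n => B n * t ^ n / INR (fact n)) (t / (exp t - 1)).

Fixpoint sumR (f : nat -> R) (n : nat) : R :=
  match n with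
  | O => 0
  | S m => sumR f m + f m
  end.

(* Main.v *)
Require Import Defs.
From Stdlib Require Import Reals Factorial Lra Lia Arith.
From Coquelicot Require Import Coquelicot.
Open Scope R_scope.

(** With [x = (2 t / PI)^2], [m_k = (2 k + 1)^2] and [mu_i = sum_(k >= 1) m_k^-(i+1)],
    the middle term of the inequality equals
    [(4 / t) x^(N+1) sum_(i >= 0) (N + i) x^i mu_(N+i)].
    All terms are positive and the lower bound keeps only [N mu_N + x mu_(N+1)].
    Since [x < 1], replacing [x^i] by [1] in the [N]-part and by [x] in the
    [i]-part increases the sum, and summing the resulting geometric series over
    [i] first yields the upper bound.

    The expansion of [t sec^2 t - tan t] behind this comes from
    [sec^2 t = sum_k (1/(a_k + t)^2 + 1/(a_k - t)^2)], [a_k = (2 k + 1) PI / 2],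
    obtained by iterating the half-angle identity for [1 / sin^2] and squeezing
    with [1/sin^2 z - 1 <= 1/z^2 <= 1/sin^2 z]; exchanging sums and integrating
    gives the power series of [tan]. Its coefficients are identified with
    Bernoulli numbers by comparing [tan * cos = sin] with [tanh * cosh = sinh]. *)

(* Coquelicot's lemmas state equalities in the carrier of [R_NormedModule],
   which [ring] and [field] do not recognise as [R]. *)
Ltac eqR := match goal with |- @eq _ ?x ?y => change (@eq R x y) end.

(** * Series *)

Lemma is_series_Rmult_l (c : R) (a : nat -> R) (l : R) :
  is_series a l -> is_series (fun n => c * a n) (c * l).
Proof. exact (is_series_scal_l c a l). Qed.

Lemma is_series_sum_n_switch (F : nat -> nat -> R) (G : nat -> R) (n : nat) :
  (forall i, is_series (fun k => F k i) (G i)) ->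
  is_series (fun k => sum_n (F k) n) (sum_n G n).
Proof.
  intros HG; induction n as [|n IH].
  - rewrite sum_O. apply is_series_ext with (2 := HG O).
    intros k; now rewrite sum_O.
  - rewrite sum_Sn.
    apply is_series_ext with (fun k => plus (sum_n (F k) n) (F k (S n))).
    + intros k; now rewrite sum_Sn.
    + exact (is_series_plus _ _ _ _ IH (HG (S n))).
Qed.

Lemma sum_n_le_series (u : nat -> R) (l : R) (n : nat) :
  (forall k, 0 <= u k) -> is_series u l -> sum_n u n <= l.
Proof.
  intros Hu Hl.
  apply (is_lim_seq_incr_compare (sum_n u) l Hl).
  intros k; rewrite sum_Sn; unfold plus; simpl; specialize (Hu (S k)); lra.
Qed.

Lemma series_le_compat (u v : nat -> R) (l l' : R) :
  (forall k, u k <= v k) -> is_series u l -> is_series v l' -> l <= l'.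
Proof.
  intros Huv Hu Hv.
  apply (is_lim_seq_le (sum_n u) (sum_n v) l l'); try assumption.
  intros n; now apply sum_n_m_le.
Qed.

(** A finite sum of column sums is the series over [k] of the row partial sums, and each of these is
    at most [H k]. *)
Lemma double_series_partial_le (F : nat -> nat -> R) (G H : nat -> R) (S : R) (n : nat) :
  (forall k i, 0 <= F k i) ->
  (forall i, is_series (fun k => F k i) (G i)) ->
  (forall k, is_series (F k) (H k)) ->
  is_series H S -> sum_n G n <= S.
Proof.
  intros HF HG HH HS.
  apply series_le_compat with (3 := HS) (2 := is_series_sum_n_switch F G n HG).
  intros k; now apply sum_n_le_series.
Qed.

(** Tonelli for nonnegative terms. The partial-sum bound makes the column sums converge to a limit
    at most [S]; the same bound for the transposed family gives the reverse inequality. *)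
Lemma double_series_switch (F : nat -> nat -> R) (G H : nat -> R) (S : R) :
  (forall k i, 0 <= F k i) ->
  (forall i, is_series (fun k => F k i) (G i)) ->
  (forall k, is_series (F k) (H k)) ->
  is_series H S -> is_series G S.
Proof.
  intros HF HG HH HS.
  assert (G0 : forall i, 0 <= G i).
  { intros i. apply Rle_trans with (sum_n (fun k => F k i) 0).
    - rewrite sum_O; apply HF.
    - apply sum_n_le_series; auto. }
  destruct (ex_finite_lim_seq_incr (sum_n G) S) as [l Hl].
  - intros n; rewrite sum_Sn; unfold plus; simpl.
    specialize (G0 (Datatypes.S n)); lra.
  - intros n; now apply (double_series_partial_le F G H).
  - assert (HGl : is_series G l) by exact Hl.
    replace S with l; [exact HGl|].
    apply Rle_antisym.
    + apply (is_lim_seq_le (sum_n G) (fun _ => S) l S); [|exact Hl|apply is_lim_seq_const].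
      intros n; now apply (double_series_partial_le F G H).
    + apply (is_lim_seq_le (sum_n H) (fun _ => l) S l); [|exact HS|apply is_lim_seq_const].
      intros n; now apply (double_series_partial_le (fun i k => F k i) H G).
Qed.

(** Cauchy square of the geometric series: the [n]-th coefficient adds [n + 1] copies of [r ^ n]. *)
Lemma is_series_succ_geom (r : R) :
  0 <= r < 1 -> is_series (fun i => INR (S i) * r ^ i) (/ (1 - r) ^ 2).
Proof.
  intros Hr.
  assert (Hg : is_series (fun n => r ^ n) (/ (1 - r))).
  { apply is_series_geom; rewrite Rabs_pos_eq; lra. }
  replace (/ (1 - r) ^ 2) with (/ (1 - r) * / (1 - r)) by (field; lra).
  apply is_series_ext with (2 := is_series_mult_pos _ _ _ _ Hg Hg
    (fun n => pow_le r n (proj1 Hr)) (fun n => pow_le r n (proj1 Hr))).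
  intros n.
  rewrite (sum_eq _ (fun _ => r ^ n)).
  - rewrite sum_cte; eqR; ring.
  - intros i Hi; rewrite <- pow_add; f_equal; lia.
Qed.

Lemma is_series_arith_geom (a b r : R) :
  0 <= r < 1 ->
  is_series (fun i => (a + b * INR i) * r ^ i) (a / (1 - r) + b * r / (1 - r) ^ 2).
Proof.
  intros Hr.
  assert (Hg : is_series (fun n => r ^ n) (/ (1 - r))).
  { apply is_series_geom; rewrite Rabs_pos_eq; lra. }
  replace (a / (1 - r) + b * r / (1 - r) ^ 2)
    with (plus (scal (a - b) (/ (1 - r))) (scal b (/ (1 - r) ^ 2)))
    by (unfold plus, scal; simpl; unfold mult; simpl; field; lra).
  eapply is_series_ext;
    [|exact (is_series_plus _ _ _ _ (is_series_scal_l (a - b) _ _ Hg)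
                (is_series_scal_l b _ _ (is_series_succ_geom r Hr)))].
  intros n; unfold plus, scal; cbn -[INR]; unfold mult; cbn -[INR]; rewrite S_INR.
  eqR; ring.
Qed.

(** * Partial fractions of the squared secant *)

Definition inv_sin2 (z : R) : R := / sin z ^ 2.

(** The second half-angle turns the sine into [cos (z / 2)], and [1/s^2 + 1/c^2 = 1/(s c)^2] when
    [s^2 + c^2 = 1]. *)
Lemma inv_sin2_half (z : R) :
  0 < z < PI -> inv_sin2 (z / 2) + inv_sin2 ((PI - z) / 2) = 4 * inv_sin2 z.
Proof.
  intros Hz; unfold inv_sin2.
  replace ((PI - z) / 2) with (PI / 2 - z / 2) by field.
  rewrite sin_shift.
  replace (sin z) with (2 * sin (z / 2) * cos (z / 2))
    by (rewrite <- sin_2a; f_equal; field).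
  assert (Hs : 0 < sin (z / 2)) by (apply sin_gt_0; lra).
  assert (Hc : 0 < cos (z / 2)) by (apply cos_gt_0; lra).
  assert (E := sin2_cos2 (z / 2)); unfold Rsqr in E.
  apply Rmult_eq_reg_r with (sin (z / 2) ^ 2 * cos (z / 2) ^ 2).
  2: apply Rgt_not_eq, Rmult_lt_0_compat; apply pow_lt; assumption.
  field_simplify; nra.
Qed.

Lemma mul_cos_lt_sin (z : R) : 0 < z < PI / 2 -> z * cos z < sin z.
Proof.
  intros Hz.
  destruct (MVT_cor2 (fun u => sin u - u * cos u) (fun u => u * sin u) 0 z)
    as [c [Hc1 Hc2]]; [lra| |].
  - intros c _. apply is_derive_Reals. auto_derive; [trivial|]. ring.
  - rewrite sin_0 in Hc1.
    assert (0 < sin c) by (apply sin_gt_0; lra).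
    assert (0 < c * sin c * (z - 0)) by (repeat apply Rmult_lt_0_compat; lra).
    lra.
Qed.

(** Since [1/sin^2 z - 1 = cot^2 z], these are the squares of [cot z <= 1/z <= 1/sin z], that is of
    [z cos z <= sin z <= z]. *)
Lemma inv_sin2_bounds (z : R) :
  0 < z < PI / 2 -> inv_sin2 z - 1 <= / z ^ 2 <= inv_sin2 z.
Proof.
  intros Hz; unfold inv_sin2.
  assert (Hs : 0 < sin z) by (apply sin_gt_0; lra).
  assert (Hc : 0 < cos z) by (apply cos_gt_0; lra).
  assert (Hsx : sin z < z) by (apply sin_lt_x; lra).
  assert (Ht := mul_cos_lt_sin z Hz).
  split.
  - replace (/ sin z ^ 2 - 1) with (cos z ^ 2 / sin z ^ 2).
    + apply Rmult_le_reg_r with (sin z ^ 2 * z ^ 2).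
      { apply Rmult_lt_0_compat; apply pow_lt; lra. }
      field_simplify; try lra.
      rewrite <- Rpow_mult_distr. apply pow_incr.
      split; [|lra]. apply Rmult_le_pos; lra.
    + assert (E := sin2_cos2 z); unfold Rsqr in E.
      replace (cos z ^ 2) with (1 - sin z ^ 2) by (simpl; lra).
      field; lra.
  - apply Rinv_le_contravar; [apply pow_lt; lra|].
    apply pow_incr; lra.
Qed.

(** The positive zeros of the cosine, hence the positive poles of the tangent. *)
Definition half_odd (k : nat) : R := (2 * INR k + 1) * PI / 2.

Lemma sumR_ext (f g : nat -> R) (n : nat) :
  (forall k, (k < n)%nat -> f k = g k) -> sumR f n = sumR g n.
Proof.
  induction n as [|n IH]; intros H; simpl; [reflexivity|].
  rewrite IH, H; auto.
Qed.

Lemma sumR_le (f g : nat -> R) (n : nat) :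
  (forall k, (k < n)%nat -> f k <= g k) -> sumR f n <= sumR g n.
Proof.
  induction n as [|n IH]; intros H; simpl; [lra|].
  apply Rplus_le_compat; auto.
Qed.

Lemma sumR_plus (f g : nat -> R) (n : nat) :
  sumR (fun k => f k + g k) n = sumR f n + sumR g n.
Proof. induction n as [|n IH]; simpl; [ring|rewrite IH; ring]. Qed.

Lemma sumR_scal (c : R) (f : nat -> R) (n : nat) :
  sumR (fun k => c * f k) n = c * sumR f n.
Proof. induction n as [|n IH]; simpl; [ring|rewrite IH; ring]. Qed.

Lemma sumR_const (c : R) (n : nat) : sumR (fun _ => c) n = INR n * c.
Proof. induction n as [|n IH]; [simpl; ring|rewrite S_INR; simpl; rewrite IH; ring]. Qed.

Lemma sum_n_sumR (f : nat -> R) (n : nat) : sum_n f n = sumR f (S n).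
Proof.
  induction n as [|n IH]; [rewrite sum_O; simpl; ring|].
  rewrite sum_Sn, IH; reflexivity.
Qed.

(** Reads the last [n] terms backwards, so that with [m = 2 K] and [n = K] the index [k] is paired
    with [2 K - 1 - k]. *)
Lemma sumR_rev_tail (f : nat -> R) (m n : nat) :
  (n <= m)%nat -> sumR f (m - n) + sumR (fun k => f (m - 1 - k)%nat) n = sumR f m.
Proof.
  induction n as [|n IH]; intros Hn; simpl.
  - rewrite Nat.sub_0_r; ring.
  - rewrite <- IH by lia.
    replace (m - n)%nat with (S (m - S n)) by lia; simpl.
    replace (m - 1 - n)%nat with (m - S n)%nat by lia; ring.
Qed.

Lemma pow2_pos_nat (n : nat) : (0 < 2 ^ n)%nat.
Proof. induction n; simpl; lia. Qed.

(* Iterating [4 / sin^2 z = 1 / sin^2 (z/2) + 1 / sin^2 ((PI - z)/2)]; the two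
   families of half-angles are exchanged by [k -> 2 K - 1 - k]. *)
Lemma inv_sin2_sum (t : R) (n : nat) :
  - (PI / 2) < t < PI / 2 ->
  sumR (fun k => inv_sin2 ((half_odd k + t) / INR (2 * 2 ^ n))
               + inv_sin2 ((half_odd k - t) / INR (2 * 2 ^ n))) (2 ^ n)
  = INR (2 * 2 ^ n) ^ 2 * / cos t ^ 2.
Proof.
  intros Ht; induction n as [|n IH].
  - unfold half_odd; simpl sumR; simpl INR.
    replace ((((2 * 0 + 1) * PI / 2 - t)) / (1 + 1)) with ((PI - (PI / 2 + t)) / 2) by field.
    replace ((((2 * 0 + 1) * PI / 2 + t)) / (1 + 1)) with ((PI / 2 + t) / 2) by field.
    rewrite inv_sin2_half by lra.
    unfold inv_sin2. rewrite <- cos_sin. ring.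
  - change (2 ^ S n)%nat with (2 * 2 ^ n)%nat.
    set (K := (2 ^ n)%nat) in *.
    assert (HK : 1 <= INR K) by (apply (le_INR 1); unfold K; apply pow2_pos_nat).
    assert (E2 : INR (2 * (2 * K)) = 2 * INR (2 * K)) by (rewrite (mult_INR 2 (2 * K)); reflexivity).
    assert (E1 : INR (2 * K) = 2 * INR K) by (rewrite (mult_INR 2 K); reflexivity).
    rewrite <- (sumR_rev_tail _ (2 * K) K) by lia.
    replace (2 * K - K)%nat with K by lia.
    rewrite <- sumR_plus.
    rewrite (sumR_ext _ (fun k => 4 * (inv_sin2 ((half_odd k + t) / INR (2 * K))
               + inv_sin2 ((half_odd k - t) / INR (2 * K))))).
    + rewrite sumR_scal, IH, E2; ring.
    + intros k Hk.
      assert (Hk' : INR k + 1 <= INR K) by (rewrite <- S_INR; apply le_INR; lia).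
      assert (Hk0 := pos_INR k).
      assert (HP := PI_RGT_0).
      rewrite Rmult_plus_distr_l.
      assert (Hrange : forall u, - (PI / 2) < u < PI / 2 ->
        0 < (half_odd k + u) / INR (2 * K) < PI).
      { intros u Hu; unfold half_odd; rewrite E1; split.
        - apply Rdiv_lt_0_compat; nra.
        - apply Rmult_lt_reg_r with (2 * INR K); [lra|].
          unfold Rdiv; rewrite Rmult_assoc, Rinv_l by lra. nra. }
      rewrite <- (inv_sin2_half ((half_odd k + t) / INR (2 * K))) by (apply Hrange; lra).
      rewrite <- (inv_sin2_half ((half_odd k - t) / INR (2 * K))) by (apply Hrange; lra).
      assert (Er : half_odd (2 * K - 1 - k) = 2 * INR K * PI - half_odd k).
      { unfold half_odd; rewrite !minus_INR, mult_INR by lia; simpl; field. }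
      rewrite Er, E2, E1.
      (* The reflection flips the sign of [t]: the reflected [+ t] term is the complementary
         half-angle of the [- t] term, and conversely. The identity therefore holds only for both
         signs together. *)
      replace ((2 * INR K * PI - half_odd k + t) / (2 * (2 * INR K)))
        with ((PI - (half_odd k - t) / (2 * INR K)) / 2) by (field; lra).
      replace ((2 * INR K * PI - half_odd k - t) / (2 * (2 * INR K)))
        with ((PI - (half_odd k + t) / (2 * INR K)) / 2) by (field; lra).
      replace ((half_odd k + t) / (2 * (2 * INR K)))
        with ((half_odd k + t) / (2 * INR K) / 2) by (field; lra).
      replace ((half_odd k - t) / (2 * (2 * INR K)))
        with ((half_odd k - t) / (2 * INR K) / 2) by (field; lra).
      ring.
Qed.

Definition sec2_term (t : R) (k : nat) : R :=
  / (half_odd k + t) ^ 2 + / (half_odd k - t) ^ 2.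

Lemma half_odd_ge (k : nat) : PI / 2 <= half_odd k.
Proof.
  unfold half_odd; assert (H := pos_INR k); assert (HP := PI_RGT_0); nra.
Qed.

Lemma sec2_term_pos (t : R) (k : nat) :
  - (PI / 2) < t < PI / 2 -> 0 < sec2_term t k.
Proof.
  intros Ht; assert (H := half_odd_ge k); unfold sec2_term.
  apply Rplus_lt_0_compat; apply Rinv_0_lt_compat, pow_lt; lra.
Qed.

(** After scaling by [(2 K)^2] with [K = 2^n], each of the [2 K] terms differs from its [inv_sin2]
    by at most [1]. The total error is thus at most [2 K / (2 K)^2 = 1 / (2 K)]. *)
Lemma sec2_partial_bounds (t : R) (n : nat) :
  - (PI / 2) < t < PI / 2 ->
  / cos t ^ 2 - / 2 * (/ 2) ^ n <= sumR (sec2_term t) (2 ^ n) <= / cos t ^ 2.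
Proof.
  intros Ht.
  assert (HS := inv_sin2_sum t n Ht).
  set (K := (2 ^ n)%nat) in *.
  assert (HK : 1 <= INR K) by (apply (le_INR 1); unfold K; apply pow2_pos_nat).
  assert (EK : INR K = 2 ^ n) by (unfold K; rewrite pow_INR; reflexivity).
  assert (E1 : INR (2 * K) = 2 * INR K) by (rewrite (mult_INR 2 K); reflexivity).
  rewrite E1 in HS.
  assert (Hb : forall k u, (k < K)%nat -> - (PI / 2) < u < PI / 2 ->
     inv_sin2 ((half_odd k + u) / (2 * INR K)) - 1
     <= (2 * INR K) ^ 2 * / (half_odd k + u) ^ 2
     <= inv_sin2 ((half_odd k + u) / (2 * INR K))).
  { intros k u Hk Hu.
    assert (Hk' : INR k + 1 <= INR K) by (rewrite <- S_INR; apply le_INR; lia).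
    assert (Hk0 := pos_INR k). assert (HP := PI_RGT_0).
    assert (Hh := half_odd_ge k).
    replace ((2 * INR K) ^ 2 * / (half_odd k + u) ^ 2)
      with (/ ((half_odd k + u) / (2 * INR K)) ^ 2) by (field; lra).
    apply inv_sin2_bounds; split.
    - apply Rdiv_lt_0_compat; lra.
    - apply Rmult_lt_reg_r with (2 * INR K); [lra|].
      unfold Rdiv at 1; rewrite Rmult_assoc, Rinv_l by lra. unfold half_odd; nra. }
  assert (HU : (2 * INR K) ^ 2 * sumR (sec2_term t) K <= (2 * INR K) ^ 2 * / cos t ^ 2).
  { rewrite <- HS, <- sumR_scal. apply sumR_le; intros k Hk; unfold sec2_term.
    assert (H1 := Hb k t Hk Ht). assert (H2 := Hb k (- t) Hk).
    unfold Rminus in *. lra. }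
  assert (HL : (2 * INR K) ^ 2 * / cos t ^ 2 - INR K * 2 <= (2 * INR K) ^ 2 * sumR (sec2_term t) K).
  { rewrite <- HS, <- sumR_scal.
    apply Rle_trans with (sumR (fun k => (inv_sin2 ((half_odd k + t) / (2 * INR K))
               + inv_sin2 ((half_odd k - t) / (2 * INR K))) + - 2) K).
    - rewrite (sumR_plus _ (fun _ => -2)), sumR_const; lra.

    - apply sumR_le; intros k Hk; unfold sec2_term.
      assert (H1 := Hb k t Hk Ht). assert (H2 := Hb k (- t) Hk).
      unfold Rminus in *. lra. }
  assert (Hpos : 0 < (2 * INR K) ^ 2) by (apply pow_lt; lra).
  split.
  - apply Rmult_le_reg_l with (1 := Hpos).
    eapply Rle_trans; [|exact HL].
    rewrite pow_inv, <- EK.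
    assert (0 < cos t) by (apply cos_gt_0; lra).
    right; field; lra.

  - now apply Rmult_le_reg_l with (1 := Hpos).
Qed.

(** The bounds control only the sums of [2 ^ n] terms. Monotonicity provides a limit of all partial
    sums, which is then identified along this subsequence. *)
Lemma is_series_sec2 (t : R) :
  - (PI / 2) < t < PI / 2 -> is_series (sec2_term t) (/ cos t ^ 2).
Proof.
  intros Ht.
  assert (Hinc : forall n, sum_n (sec2_term t) n <= sum_n (sec2_term t) (S n)).
  { intros n; rewrite sum_Sn; unfold plus; simpl.
    assert (H := sec2_term_pos t (S n) Ht); lra. }
  assert (Hle : forall n m, (n <= m)%nat -> sum_n (sec2_term t) n <= sum_n (sec2_term t) m).
  { intros n m H; induction H; [lra|]. eapply Rle_trans; [eassumption|apply Hinc]. }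
  assert (Hpow : forall n, (n < 2 ^ n)%nat) by (intros n; apply Nat.pow_gt_lin_r; lia).
  assert (Hsub : forall n, sumR (sec2_term t) (2 ^ n) = sum_n (sec2_term t) (2 ^ n - 1)).
  { intros n; rewrite sum_n_sumR; f_equal; generalize (Hpow n); lia. }
  destruct (ex_finite_lim_seq_incr (sum_n (sec2_term t)) (/ cos t ^ 2)) as [l Hl].
  - exact Hinc.
  - intros n; apply Rle_trans with (sumR (sec2_term t) (2 ^ S n)).
    + rewrite Hsub; apply Hle; generalize (Hpow (S n)); lia.
    + now apply sec2_partial_bounds.
  - assert (Hl' : is_lim_seq (fun n => sumR (sec2_term t) (2 ^ n)) l).
    { apply is_lim_seq_ext with (fun n => sum_n (sec2_term t) (2 ^ n - 1)); [auto|].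
      apply (is_lim_seq_subseq (sum_n (sec2_term t)) l (fun n => (2 ^ n - 1)%nat)); [|exact Hl].
      intros P [n0 H0]; exists (S n0); intros n Hn; apply H0; generalize (Hpow n); lia. }
    assert (Hc : is_lim_seq (fun n => sumR (sec2_term t) (2 ^ n)) (/ cos t ^ 2)).
    { apply is_lim_seq_le_le with (fun n => / cos t ^ 2 - / 2 * (/ 2) ^ n) (fun _ => / cos t ^ 2).
      - intros n; now apply sec2_partial_bounds.
      - replace (Finite (/ cos t ^ 2)) with (Finite (/ cos t ^ 2 - / 2 * 0)) by (f_equal; ring).
        apply is_lim_seq_minus'; [apply is_lim_seq_const|].
        apply is_lim_seq_mult'; [apply is_lim_seq_const|].
        apply is_lim_seq_geom; rewrite Rabs_pos_eq; lra.
      - apply is_lim_seq_const. }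
    assert (E := is_lim_seq_unique _ _ Hl'). rewrite (is_lim_seq_unique _ _ Hc) in E.
    rewrite (f_equal real E : / cos t ^ 2 = l). exact Hl.
Qed.

(** * The power series of the tangent *)

Lemma ex_pseries_le_CV_radius (a : nat -> R) (r : R) :
  ex_pseries a r -> Rbar_le (Rabs r) (CV_radius a).
Proof.
  intros [l Hl]. apply Rbar_not_lt_le; intros Hlt.
  apply (CV_disk_outside a r Hlt).
  apply ex_series_lim_0. exists l. now apply is_pseries_R.
Qed.

(** Convergence at the midpoint of [Rabs t] and [rho] makes the inequality strict. *)
Lemma lt_CV_radius (a : nat -> R) (f : R -> R) (rho t : R) :
  (forall u, Rabs u < rho -> is_pseries a u (f u)) ->
  Rabs t < rho -> Rbar_lt (Rabs t) (CV_radius a).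
Proof.
  intros Ha Ht. assert (H0 := Rabs_pos t).
  set (u := (Rabs t + rho) / 2).
  assert (Hu : Rabs u = u) by (apply Rabs_pos_eq; unfold u; lra).
  apply Rbar_lt_le_trans with (Rabs u).
  - rewrite Hu; unfold u; simpl; lra.
  - apply ex_pseries_le_CV_radius. exists (f u). apply Ha. rewrite Hu; unfold u; lra.
Qed.

Definition odd_sq (k : nat) : R := (2 * INR k + 1) ^ 2.

Lemma odd_sq_ge_1 (k : nat) : 1 <= odd_sq k.
Proof. unfold odd_sq; assert (H := pos_INR k); nra. Qed.

Lemma half_odd_sq (k : nat) : half_odd k ^ 2 = odd_sq k * (PI / 2) ^ 2.
Proof. unfold half_odd, odd_sq; field. Qed.

(** The sum of [1 / m^(2 i + 2)] over odd [m >= 1], that is [(1 - 2^-(2 i + 2)) zeta(2 i + 2)]. *)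
Definition odd_zeta (i : nat) : R := Series (fun k => / odd_sq k ^ S i).

Lemma is_series_odd_zeta (i : nat) :
  is_series (fun k => / odd_sq k ^ S i) (odd_zeta i).
Proof.
  apply Series_correct.
  apply (@ex_series_le R_AbsRing R_CompleteNormedModule _ (fun k => / odd_sq k)).
  - intros k; change (Rabs (/ odd_sq k ^ S i) <= / odd_sq k).
    assert (H := odd_sq_ge_1 k).
    rewrite Rabs_pos_eq by (left; apply Rinv_0_lt_compat, pow_lt; lra).
    apply Rinv_le_contravar; [lra|].
    assert (H1 := pow_R1_Rle (odd_sq k) i H). simpl; nra.
  - assert (HP := PI_RGT_0).
    (* The dominating series of inverse odd squares is the secant expansion at [t = 0], where each
       term is [8 / (PI^2 m_k)]. *)
    exists (PI ^ 2 / 8 * / cos 0 ^ 2).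
    eapply is_series_ext; [|apply (is_series_Rmult_l (PI ^ 2 / 8)), is_series_sec2; lra].
    intros k; unfold sec2_term. eqR.
    rewrite Rplus_0_r, Rminus_0_r.
    rewrite half_odd_sq. assert (H := odd_sq_ge_1 k). field; lra.
Qed.

(** The coefficient of [t^(2 i + 1)] in [tan t]. *)
Definition tan_coef (i : nat) : R := 2 * (2 / PI) ^ (2 * i + 2) * odd_zeta i.

Lemma odd_zeta_pos (i : nat) : 0 < odd_zeta i.
Proof.
  apply Rlt_le_trans with (/ odd_sq 0 ^ S i).
  - apply Rinv_0_lt_compat, pow_lt; generalize (odd_sq_ge_1 0); lra.
  - replace (/ odd_sq 0 ^ S i) with (sum_n (fun k => / odd_sq k ^ S i) 0)
      by apply sum_O.
    apply sum_n_le_series; [|apply is_series_odd_zeta].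
    intros k; left; apply Rinv_0_lt_compat, pow_lt; generalize (odd_sq_ge_1 k); lra.
Qed.

Lemma tan_coef_pos (i : nat) : 0 < tan_coef i.
Proof.
  unfold tan_coef. assert (HP := PI_RGT_0).
  apply Rmult_lt_0_compat; [|apply odd_zeta_pos].
  apply Rmult_lt_0_compat; [lra|]. apply pow_lt, Rdiv_lt_0_compat; lra.
Qed.

(** With [a = half_odd k] and [r = t^2 / a^2], a pair of partial fractions is
    [(2 / a^2) (1 + r) / (1 - r)^2], whose expansion is [(2 / a^2)] times the sum of
    [(1 + 2 i) r^i]. Summing over [k] first gives the coefficients. *)
Lemma is_series_sec2_coef (t : R) :
  - (PI / 2) < t < PI / 2 ->
  is_series (fun i => (1 + 2 * INR i) * tan_coef i * (t ^ 2) ^ i) (/ cos t ^ 2).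
Proof.
  intros Ht. assert (HP := PI_RGT_0).
  set (F := fun k i => 2 / half_odd k ^ 2 *
              ((1 + 2 * INR i) * (t ^ 2 / half_odd k ^ 2) ^ i)).
  assert (Hr : forall k, 0 <= t ^ 2 / half_odd k ^ 2 < 1).
  { intros k. assert (H := half_odd_ge k).
    assert (0 < half_odd k ^ 2) by (apply pow_lt; lra). split.
    - apply Rdiv_le_0_compat; [apply pow2_ge_0|assumption].
    - apply Rmult_lt_reg_r with (half_odd k ^ 2); [assumption|].
      unfold Rdiv; rewrite Rmult_assoc, Rinv_l by lra. nra. }
  apply (double_series_switch F _ (sec2_term t)).
  - intros k i; unfold F. assert (H := half_odd_ge k).
    apply Rmult_le_pos; [apply Rdiv_le_0_compat; [lra|apply pow_lt; lra]|].
    apply Rmult_le_pos; [generalize (pos_INR i); lra|apply pow_le, Hr].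
  - intros i.
    eapply is_series_ext; [|replace ((1 + 2 * INR i) * tan_coef i * (t ^ 2) ^ i)
      with ((1 + 2 * INR i) * (2 * (2 / PI) ^ (2 * i + 2)) * (t ^ 2) ^ i * odd_zeta i);
      [apply is_series_Rmult_l, is_series_odd_zeta|]].
    + intros k; unfold F; eqR.
      rewrite half_odd_sq. assert (H := odd_sq_ge_1 k).
      replace (2 * i + 2)%nat with (2 * S i)%nat by lia.
      rewrite pow_mult.
      replace (t ^ 2 / (odd_sq k * (PI / 2) ^ 2)) with (t ^ 2 * ((2 / PI) ^ 2 * / odd_sq k))
        by (field; lra).
      rewrite !Rpow_mult_distr, pow_inv. simpl.
      field. repeat split; try lra. apply pow_nonzero; lra.
    + unfold tan_coef; ring.
  - intros k; unfold F. assert (H := half_odd_ge k).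
    replace (sec2_term t k) with (2 / half_odd k ^ 2 *
      (1 / (1 - t ^ 2 / half_odd k ^ 2)
       + 2 * (t ^ 2 / half_odd k ^ 2) / (1 - t ^ 2 / half_odd k ^ 2) ^ 2)).
    + apply is_series_Rmult_l, is_series_arith_geom, Hr.
    + unfold sec2_term.
      field. repeat split; try lra. nra.
  - now apply is_series_sec2.
Qed.

Definition tan_ps (n : nat) : R := if Nat.odd n then tan_coef (Nat.div2 n) else 0.

Lemma odd_double (n : nat) : Nat.odd (2 * n) = false.
Proof. rewrite Nat.odd_mul; reflexivity. Qed.

Lemma odd_double_succ (n : nat) : Nat.odd (S (2 * n)) = true.
Proof. rewrite Nat.odd_succ, Nat.even_mul; reflexivity. Qed.

Lemma is_pseries_zero (x : R) : is_pseries (fun _ => 0) x 0.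
Proof.
  apply is_pseries_R.
  assert (H : is_series (fun n => 0 * 0 ^ n) (0 * / (1 - 0))).
  { apply is_series_Rmult_l, is_series_geom; rewrite Rabs_R0; lra. }
  rewrite Rmult_0_l in H.
  apply is_series_ext with (2 := H); intros n; eqR; ring.
Qed.

Lemma is_pseries_sec2 (t : R) :
  Rabs t < PI / 2 -> is_pseries (PS_derive tan_ps) t (/ cos t ^ 2).
Proof.
  intros Ht; apply Rabs_def2 in Ht.
  replace (/ cos t ^ 2) with (/ cos t ^ 2 + t * 0) by ring.
  apply is_pseries_odd_even; unfold PS_derive, tan_ps.
  - apply is_pseries_R.
    eapply is_series_ext; [|apply is_series_sec2_coef; lra].
    intros i; eqR. rewrite odd_double_succ, Nat.div2_succ_double.
    rewrite S_INR, mult_INR. simpl; ring.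
  - eapply is_pseries_ext; [|apply is_pseries_zero].
    intros i; eqR. replace (S (2 * i + 1)) with (2 * S i)%nat by lia.
    rewrite odd_double; ring.
Qed.

(** The sum of the series and [tan] have the same derivative and both vanish at [0], so the mean
    value theorem makes them equal. *)
Lemma is_pseries_tan (t : R) : Rabs t < PI / 2 -> is_pseries tan_ps t (tan t).
Proof.
  intros Ht.
  assert (Hr : forall u, Rabs u < PI / 2 -> Rbar_lt (Rabs u) (CV_radius tan_ps)).
  { intros u Hu; rewrite <- CV_radius_derive.
    apply lt_CV_radius with (2 := Hu) (1 := is_pseries_sec2). }
  assert (E : PSeries tan_ps t = tan t).
  { assert (Hd : forall u, Rabs u <= Rabs t ->
      is_derive (fun x => PSeries tan_ps x - tan x) u 0).
    { intros u Hu. assert (Hu' : Rabs u < PI / 2) by lra.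
      assert (Hc : 0 < cos u) by (apply Rabs_def2 in Hu'; apply cos_gt_0; lra).
      replace 0 with (minus (PSeries (PS_derive tan_ps) u) (tan u ^ 2 + 1)).
      - apply (is_derive_minus (PSeries tan_ps) tan).
        + apply is_derive_PSeries; auto.
        + apply is_derive_tan; lra.
      - rewrite (is_pseries_unique _ _ _ (is_pseries_sec2 u Hu')).
        unfold minus, plus, opp, tan; simpl.
        assert (E2 := sin2_cos2 u); unfold Rsqr in E2.
        apply Rmult_eq_reg_r with (cos u ^ 2); [|apply pow_nonzero; lra].
        field_simplify; [nra|lra]. }
    destruct (MVT_cor4 (fun x => PSeries tan_ps x - tan x) (fun _ => 0) 0 (Rabs t))
      with (b := t) as [c [Hc _]].
    - intros u Hu; apply Hd; now rewrite Rminus_0_r in Hu.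
    - rewrite Rminus_0_r; lra.
    - rewrite PSeries_0, tan_0 in Hc. unfold tan_ps in Hc at 2; simpl in Hc. lra. }
  rewrite <- E. apply PSeries_correct, CV_radius_inside; auto.
Qed.

(** Passing to odd indices alone requires convergence of that subseries beforehand; it is dominated
    by the series of [1 / cos t ^ 2]. *)
Lemma is_series_tan (t : R) :
  0 < t < PI / 2 -> is_series (fun i => t * (tan_coef i * (t ^ 2) ^ i)) (tan t).
Proof.
  intros Ht.
  assert (Ht' : Rabs t < PI / 2) by (rewrite Rabs_pos_eq; lra).
  assert (Hex : ex_series (fun i => tan_coef i * (t ^ 2) ^ i)).
  { apply (@ex_series_le R_AbsRing R_CompleteNormedModule) with
      (fun i => (1 + 2 * INR i) * tan_coef i * (t ^ 2) ^ i).
    - intros i. change (Rabs (tan_coef i * (t ^ 2) ^ i)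
        <= (1 + 2 * INR i) * tan_coef i * (t ^ 2) ^ i).
      assert (H := tan_coef_pos i).
      assert (H2 : 0 <= (t ^ 2) ^ i) by apply pow_le, pow2_ge_0.
      assert (H3 := pos_INR i).
      rewrite Rabs_pos_eq by (apply Rmult_le_pos; lra).
      rewrite Rmult_assoc.
      assert (0 <= tan_coef i * (t ^ 2) ^ i) by (apply Rmult_le_pos; lra).
      nra.
    - exists (/ cos t ^ 2). apply is_series_sec2_coef; lra. }
  destruct Hex as [l Hl].
  assert (H : is_pseries tan_ps t (0 + t * l)).
  { apply is_pseries_odd_even; unfold tan_ps.
    - eapply is_pseries_ext; [|apply is_pseries_zero].
      intros i; eqR; now rewrite odd_double.
    - apply is_pseries_R. eapply is_series_ext; [|exact Hl].
      intros i; eqR. replace (2 * i + 1)%nat with (S (2 * i)) by lia.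
      now rewrite odd_double_succ, Nat.div2_succ_double. }
  assert (E := is_pseries_unique _ _ _ H).
  rewrite (is_pseries_unique _ _ _ (is_pseries_tan t Ht')) in E.
  rewrite E, Rplus_0_l. apply (is_series_Rmult_l t _ _ Hl).
Qed.

(** * Bernoulli numbers *)

(** Uniqueness of power series coefficients turns a product of functions near [0] into a Cauchy
    product. *)
Lemma PS_mult_eq (a b c : nat -> R) (f g : R -> R) (rho : R) (n : nat) :
  0 < rho ->
  (forall t, Rabs t < rho -> is_pseries a t (f t)) ->
  (forall t, Rabs t < rho -> is_pseries b t (g t)) ->
  (forall t, Rabs t < rho -> is_pseries c t (f t * g t)) ->
  PS_mult a b n = c n.
Proof.
  intros Hrho Ha Hb Hc.
  assert (Hab : forall t, Rabs t < rho -> is_pseries (PS_mult a b) t (f t * g t)).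
  { intros t Ht; apply is_pseries_mult; auto.
    - now apply lt_CV_radius with (1 := Ha).
    - now apply lt_CV_radius with (1 := Hb). }
  assert (H0 : Rabs 0 < rho) by now rewrite Rabs_R0.
  apply PSeries_ext_recip.
  - rewrite <- Rabs_R0. now apply lt_CV_radius with (1 := Hab).
  - rewrite <- Rabs_R0. now apply lt_CV_radius with (1 := Hc).
  - exists (mkposreal rho Hrho); intros t Ht.
    change (Rabs (t - 0) < rho) in Ht; rewrite Rminus_0_r in Ht.
    rewrite (is_pseries_unique _ _ _ (Hab t Ht)).
    now rewrite (is_pseries_unique _ _ _ (Hc t Ht)).
Qed.

(** Strong induction: by the induction hypothesis the Cauchy products differ only in their last
    term, [a n * b 0]. *)
Lemma PS_mult_cancel_r (a a' b : nat -> R) :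
  b O = 1 -> (forall n, PS_mult a b n = PS_mult a' b n) -> forall n, a n = a' n.
Proof.
  intros Hb H n; induction n as [n IH] using lt_wf_ind.
  specialize (H n); unfold PS_mult in H; destruct n as [|n].
  - simpl in H; rewrite Hb in H; lra.
  - rewrite !tech5, !Nat.sub_diag, Hb in H.
    rewrite (sum_eq _ (fun k => a' k * b (S n - k)%nat)) in H.
    + lra.
    + intros k Hk; rewrite IH by lia; reflexivity.
Qed.

(** * Power series of the hyperbolic and circular functions *)

Definition cosh_ps (n : nat) : R := if Nat.odd n then 0 else / INR (fact n).
Definition sinh_ps (n : nat) : R := if Nat.odd n then / INR (fact n) else 0.
(** The circular coefficients are signed hyperbolic ones, so that comparing [tan] with [tanh] is a
    matter of signs. *)
Definition cos_ps (n : nat) : R := (-1) ^ Nat.div2 n * cosh_ps n.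
Definition sin_ps (n : nat) : R := (-1) ^ Nat.div2 n * sinh_ps n.

Lemma pow_minus1_odd (n : nat) : (-1) ^ n = if Nat.odd n then -1 else 1.
Proof.
  induction n as [|n IH]; [reflexivity|].
  simpl pow. rewrite IH, Nat.odd_succ, <- Nat.negb_odd.
  destruct (Nat.odd n); simpl; ring.
Qed.

Lemma pow_minus1_sq (n : nat) : (-1) ^ n * (-1) ^ n = 1.
Proof. rewrite pow_minus1_odd; destruct (Nat.odd n); ring. Qed.

Lemma is_pseries_exp_opp (t : R) :
  is_pseries (fun n => (-1) ^ n * / INR (fact n)) t (exp (- t)).
Proof.
  apply is_pseries_R.
  apply is_series_ext with (2 := proj1 (is_pseries_R _ _ _) (is_exp_Reals (- t))).
  intros n; eqR. replace (- t) with (-1 * t) by ring.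
  rewrite Rpow_mult_distr; ring.
Qed.

Lemma is_pseries_cosh (t : R) : is_pseries cosh_ps t (cosh t).
Proof.
  apply is_pseries_R.
  assert (H := is_series_Rmult_l (/ 2) _ _ (is_series_plus _ _ _ _
    (proj1 (is_pseries_R _ _ _) (is_exp_Reals t))
    (proj1 (is_pseries_R _ _ _) (is_pseries_exp_opp t)))).
  unfold plus in H; simpl in H.
  replace (cosh t) with (/ 2 * (exp t + exp (- t))) by (unfold cosh; field).
  apply is_series_ext with (2 := H).
  intros n; eqR. rewrite pow_minus1_odd; unfold cosh_ps.
  destruct (Nat.odd n); field; apply INR_fact_neq_0.
Qed.

Lemma is_pseries_sinh (t : R) : is_pseries sinh_ps t (sinh t).
Proof.
  apply is_pseries_R.
  assert (H := is_series_Rmult_l (/ 2) _ _ (is_series_minus _ _ _ _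
    (proj1 (is_pseries_R _ _ _) (is_exp_Reals t))
    (proj1 (is_pseries_R _ _ _) (is_pseries_exp_opp t)))).
  unfold plus, opp in H; simpl in H.
  replace (sinh t) with (/ 2 * (exp t + - exp (- t))) by (unfold sinh; field).
  apply is_series_ext with (2 := H).
  intros n; eqR. rewrite pow_minus1_odd; unfold sinh_ps.
  destruct (Nat.odd n); field; apply INR_fact_neq_0.
Qed.

Lemma is_pseries_cos (t : R) : is_pseries cos_ps t (cos t).
Proof.
  replace (cos t) with (cos t + t * 0) by ring.
  apply is_pseries_odd_even; unfold cos_ps, cosh_ps.
  - apply is_pseries_R. unfold cos; destruct (exist_cos (Rsqr t)) as [l Hl].
    apply is_series_Reals in Hl. apply is_series_ext with (2 := Hl).
    intros n; eqR. rewrite odd_double, Nat.div2_double. unfold cos_n, Rsqr.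
    simpl; rewrite Rmult_1_r; reflexivity.
  - eapply is_pseries_ext; [|apply is_pseries_zero].
    intros n; eqR. replace (2 * n + 1)%nat with (S (2 * n)) by lia.
    rewrite odd_double_succ; ring.
Qed.

Lemma is_pseries_sin (t : R) : is_pseries sin_ps t (sin t).
Proof.
  replace (sin t) with (0 + sin t) by ring.
  unfold sin; destruct (exist_sin (Rsqr t)) as [l Hl].
  apply is_pseries_odd_even; unfold sin_ps, sinh_ps.
  - eapply is_pseries_ext; [|apply is_pseries_zero].
    intros n; eqR. rewrite odd_double; ring.
  - apply is_pseries_R.
    apply is_series_Reals in Hl. apply is_series_ext with (2 := Hl).
    intros n; eqR. unfold sin_n, Rsqr, Rdiv.
    replace (2 * n + 1)%nat with (S (2 * n)) by lia.
    rewrite odd_double_succ, Nat.div2_succ_double.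
    simpl; rewrite Rmult_1_r; reflexivity.
Qed.

(** Coefficients of [t tanh t]; the extra [1] at index [1] comes from a linear summand [t]. *)
Definition xtanh_ps (B : nat -> R) (n : nat) : R :=
  B n * (4 ^ n - 2 ^ n) / INR (fact n) + (if Nat.eqb n 1 then 1 else 0).

(* [t tanh t = t - g (2 t) + g (4 t)] for [g s = s / (e^s - 1)]. *)
Lemma is_pseries_xtanh (B : nat -> R) (t : R) :
  is_bernoulli B -> Rabs t < 1 -> is_pseries (xtanh_ps B) t (t * (sinh t / cosh t)).
Proof.
  intros HB Ht. assert (HP := PI2_1).
  destruct (Req_dec t 0) as [->|H0].
  - replace (0 * (sinh 0 / cosh 0)) with (xtanh_ps B 0)
      by (unfold xtanh_ps, Rdiv; simpl; ring).
    exact (is_pseries_0 (V := R_NormedModule) (xtanh_ps B)).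
  - assert (Hp : 0 < Rabs t) by now apply Rabs_pos_lt.
    (* The generating function is used at [2 t] and [4 t]; [Rabs t < 1] and [4 < 2 PI] keep both in
       its domain. *)
    assert (Hg : forall c, 0 < c <= 4 -> is_series (fun n => B n * (c * t) ^ n / INR (fact n))
       (c * t / (exp (c * t) - 1))).
    { intros c Hc; apply is_series_Reals, HB.
      rewrite Rabs_mult, (Rabs_pos_eq c) by lra. split; nra. }
    assert (H1 : is_series (fun n => (if Nat.eqb n 1 then 1 else 0) * t ^ n) t).
    { apply is_series_decr_1, is_series_decr_1.
      apply is_series_ext with (fun n => 0 * t ^ n); [intros n; eqR; simpl; ring|].
      assert (Hz := proj1 (is_pseries_R _ _ _) (is_pseries_zero t)).
      replace (plus _ _) with 0; [exact Hz|].
      unfold plus, opp; simpl; ring. }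
    assert (H := is_series_plus _ _ _ _ (is_series_minus _ _ _ _
       (Hg 4 ltac:(lra)) (Hg 2 ltac:(lra))) H1).
    unfold plus, opp in H; simpl in H.
    apply is_pseries_R.
    replace (t * (sinh t / cosh t)) with
      (4 * t / (exp (4 * t) - 1) + - (2 * t / (exp (2 * t) - 1)) + t).
    + apply is_series_ext with (2 := H).
      intros n; eqR; unfold xtanh_ps. rewrite !Rpow_mult_distr.
      field; apply INR_fact_neq_0.
    + set (u := exp t).
      assert (Hu : 0 < u) by apply exp_pos.
      assert (Hu1 : u <> 1).
      { intros Hu1; apply H0, exp_inv. now rewrite exp_0. }
      assert (E2 : exp (2 * t) = u ^ 2).
      { replace (2 * t) with (t + t) by ring. rewrite exp_plus; unfold u; ring. }
      assert (E4 : exp (4 * t) = u ^ 4).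
      { replace (4 * t) with (2 * t + 2 * t) by ring. rewrite exp_plus, E2; ring. }
      unfold sinh, cosh; rewrite exp_Ropp, E2, E4. fold u.
      assert (u ^ 2 - 1 <> 0) by (intros E; apply Hu1; nra).
      assert (u ^ 2 + 1 <> 0) by nra.
      field. repeat split; try nra.
Qed.

Definition xtan_ps : nat -> R := PS_incr_1 tan_ps.

Lemma is_pseries_xtan (t : R) :
  Rabs t < 1 -> is_pseries xtan_ps t (t * (sin t / cos t)).
Proof.
  intros Ht. assert (HP := PI2_1).
  apply (is_pseries_incr_1 tan_ps t), is_pseries_tan; lra.
Qed.

(* The substitution [t -> i t] at the level of coefficients. *)
Definition rot_sign (n : nat) : R := if Nat.odd n then 0 else - (-1) ^ Nat.div2 n.

Lemma PS_mult_xtan_cos (n : nat) : PS_mult xtan_ps cos_ps n = PS_incr_1 sin_ps n.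
Proof.
  apply PS_mult_eq with (f := fun t => t * (sin t / cos t)) (g := cos) (rho := 1).
  - lra.
  - apply is_pseries_xtan.
  - intros t _; apply is_pseries_cos.
  - intros t Ht. assert (HP := PI2_1). apply Rabs_def2 in Ht.
    assert (0 < cos t) by (apply cos_gt_0; lra).
    replace (t * (sin t / cos t) * cos t) with (t * sin t) by (field; lra).
    apply (is_pseries_incr_1 sin_ps t), is_pseries_sin.
Qed.

Lemma PS_mult_xtanh_cosh (B : nat -> R) (n : nat) :
  is_bernoulli B -> PS_mult (xtanh_ps B) cosh_ps n = PS_incr_1 sinh_ps n.
Proof.
  intros HB; apply PS_mult_eq with (f := fun t => t * (sinh t / cosh t)) (g := cosh) (rho := 1).
  - lra.
  - intros t Ht; now apply is_pseries_xtanh.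
  - intros t _; apply is_pseries_cosh.
  - intros t Ht.
    assert (0 < cosh t).
    { unfold cosh; generalize (exp_pos t) (exp_pos (- t)); lra. }
    replace (t * (sinh t / cosh t) * cosh t) with (t * sinh t) by (field; lra).
    apply (is_pseries_incr_1 sinh_ps t), is_pseries_sinh.
Qed.

(** Replacing [t] by [i t] turns [t tan t] into [- t tanh t], whence the minus sign in [rot_sign].
    Both sequences have the same product with [cosh_ps], namely the coefficients of [t sinh t], and
    [cosh_ps] can be cancelled. *)
Lemma xtan_xtanh (B : nat -> R) (n : nat) :
  is_bernoulli B -> rot_sign n * xtan_ps n = xtanh_ps B n.
Proof.
  intros HB.
  apply (PS_mult_cancel_r (fun n => rot_sign n * xtan_ps n) (xtanh_ps B) cosh_ps).
  { unfold cosh_ps; simpl; field. }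
  clear n; intros n. rewrite PS_mult_xtanh_cosh by assumption.
  replace (PS_incr_1 sinh_ps n) with (rot_sign n * PS_incr_1 sin_ps n).
  - rewrite <- PS_mult_xtan_cos; unfold PS_mult. rewrite scal_sum.
    apply sum_eq; intros k Hk.
    unfold rot_sign, cos_ps, cosh_ps.
    destruct (Nat.odd k) eqn:Ek.
    (* For odd [k] both sides vanish: [rot_sign n = 0] if [n] is odd, and otherwise [xtan_ps k = 0]
       because [tan_ps] has no even terms. *)
    + destruct (Nat.odd n) eqn:En; [ring|].
      destruct k as [|k]; [discriminate|].
      unfold xtan_ps, PS_incr_1, tan_ps.
      rewrite Nat.odd_succ, <- Nat.negb_odd in Ek.
      destruct (Nat.odd k); [discriminate|ring].
    + rewrite Nat.odd_sub, Ek by assumption.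
      destruct (Nat.odd n) eqn:En; [simpl; ring|simpl].
      rewrite <- Nat.negb_even in Ek, En.
      apply Bool.negb_false_iff, Nat.even_spec in Ek, En.
      destruct Ek as [j ->], En as [m ->].
      assert (exists l, m = (j + l)%nat) as [l ->] by (exists (m - j)%nat; lia).
      replace (2 * (j + l) - 2 * j)%nat with (2 * l)%nat by lia.
      rewrite !Nat.div2_double, pow_add.
      transitivity (- (-1) ^ j * xtan_ps (2 * j) * / INR (fact (2 * l)) * ((-1) ^ l * (-1) ^ l));
        [rewrite pow_minus1_sq; ring|ring].
  - destruct n as [|n]; [exact (Rmult_0_r _)|].
    unfold PS_incr_1, sin_ps, sinh_ps, rot_sign.
    rewrite Nat.odd_succ, <- Nat.negb_odd.
    destruct (Nat.odd n) eqn:En; simpl negb; [|ring]. cbv iota.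
    apply Nat.odd_spec in En; destruct En as [m ->].
    replace (S (2 * m + 1)) with (2 * S m)%nat by lia.
    replace (2 * m + 1)%nat with (S (2 * m)) by lia.
    rewrite Nat.div2_double, Nat.div2_succ_double.
    transitivity ((-1) ^ m * (-1) ^ m * / INR (fact (S (2 * m)))); [cbn [pow]; ring|].
    rewrite pow_minus1_sq; ring.
Qed.

(** The coefficients of index [2 i + 2] agree up to sign; absolute values remove the sign because
    [tan_coef i] is positive. *)
Lemma tan_coef_bernoulli (B : nat -> R) (i : nat) :
  is_bernoulli B ->
  tan_coef i = 2 ^ (2 * i + 2) * (2 ^ (2 * i + 2) - 1) * Rabs (B (2 * i + 2)%nat)
               / INR (fact (2 * i + 2)).
Proof.
  intros HB. assert (E := xtan_xtanh B (2 * S i) HB).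
  unfold xtanh_ps in E.
  replace (Nat.eqb (2 * S i) 1) with false in E by (symmetry; apply Nat.eqb_neq; lia).
  rewrite Rplus_0_r in E. apply (f_equal Rabs) in E.
  replace (xtan_ps (2 * S i)) with (tan_coef i) in E.
  2:{ replace (2 * S i)%nat with (S (S (2 * i))) by lia.
      unfold xtan_ps, PS_incr_1, tan_ps.
      now rewrite odd_double_succ, Nat.div2_succ_double. }
  rewrite Rabs_mult in E. unfold rot_sign in E.
  rewrite odd_double, Rabs_Ropp, pow_1_abs, Rmult_1_l in E.
  rewrite (Rabs_pos_eq (tan_coef i)) in E by (left; apply tan_coef_pos).
  rewrite E. replace (2 * S i)%nat with (2 * i + 2)%nat by lia.
  set (n := (2 * i + 2)%nat).
  assert (H1 : 1 <= 2 ^ n) by (apply pow_R1_Rle; lra).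
  replace (4 ^ n) with (2 ^ n * 2 ^ n) by (rewrite <- Rpow_mult_distr; f_equal; ring).
  unfold Rdiv; rewrite !Rabs_mult, Rabs_inv.
  rewrite (Rabs_pos_eq (INR (fact n))) by apply pos_INR.
  rewrite (Rabs_pos_eq (2 ^ n * 2 ^ n - 2 ^ n)) by nra.
  ring.
Qed.

(** * The remainder of the expansion *)

Definition odd_zeta_tail (i : nat) : R := odd_zeta i - 1.

Lemma is_series_odd_zeta_tail (i : nat) :
  is_series (fun k => / odd_sq (S k) ^ S i) (odd_zeta_tail i).
Proof.
  apply (is_series_incr_1 (fun k => / odd_sq k ^ S i)).
  replace (plus _ _) with (odd_zeta i); [apply is_series_odd_zeta|].
  unfold odd_zeta_tail, odd_sq, plus; cbn [AbelianMonoid.plus]; simpl INR.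
  replace (2 * 0 + 1) with 1 by ring. rewrite !pow1, Rinv_1. simpl; ring.
Qed.

Lemma odd_zeta_tail_pos (i : nat) : 0 < odd_zeta_tail i.
Proof.
  apply Rlt_le_trans with (/ odd_sq 1 ^ S i).
  - apply Rinv_0_lt_compat, pow_lt; generalize (odd_sq_ge_1 1); lra.
  - replace (/ odd_sq 1 ^ S i) with (sum_n (fun k => / odd_sq (S k) ^ S i) 0)
      by apply sum_O.
    apply sum_n_le_series; [|apply is_series_odd_zeta_tail].
    intros k; left; apply Rinv_0_lt_compat, pow_lt; generalize (odd_sq_ge_1 (S k)); lra.
Qed.

(** Translates to the index [K = k + 2] of the sums [S1] and [S2]. The factor in
    [m - 1 = 4 K (K - 1)] is the origin of the constants [4] and [16] below. *)
Lemma odd_sq_succ (k : nat) :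
  odd_sq (S k) = (2 * INR (k + 2) - 1) ^ 2 /\
  odd_sq (S k) - 1 = 4 * INR (k + 2) * (INR (k + 2) - 1) /\ 2 <= INR (k + 2).
Proof.
  unfold odd_sq; rewrite S_INR, plus_INR; simpl (INR 2).
  assert (H := pos_INR k). repeat split; try ring; lra.
Qed.

(** For fixed [k], with [m = odd_sq (S k)], summing over [i] first gives
    [m^-N (a / (m - 1) + b / (m - 1)^2)], whose two parts are the summands of [S1] and [S2]. *)
Lemma is_series_weighted_tail (N : nat) (S1 S2 a b : R) :
  0 <= a -> 0 <= b ->
  infinite_sum (fun i => let k := INR (i + 2) in
     1 / ((2 * k - 1) ^ (2 * N) * k * (k - 1))) S1 ->
  infinite_sum (fun i => let k := INR (i + 2) in
     1 / ((2 * k - 1) ^ (2 * N) * k ^ 2 * (k - 1) ^ 2)) S2 ->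
  is_series (fun i => (a + b * INR i) * odd_zeta_tail (N + i)) (a / 4 * S1 + b / 16 * S2).
Proof.
  intros Ha Hb H1 H2.
  apply is_series_Reals in H1, H2.
  set (F := fun k i => (a + b * INR i) * / odd_sq (S k) ^ S (N + i)).
  apply (double_series_switch F _
    (fun k => / odd_sq (S k) ^ S N *
       (a / (1 - / odd_sq (S k)) + b * / odd_sq (S k) / (1 - / odd_sq (S k)) ^ 2))).
  - intros k i; unfold F. assert (H := odd_sq_ge_1 (S k)).
    apply Rmult_le_pos.
    + assert (H0 := pos_INR i). nra.
    + left; apply Rinv_0_lt_compat, pow_lt; lra.
  - intros i; apply is_series_Rmult_l, is_series_odd_zeta_tail.
  - intros k. destruct (odd_sq_succ k) as [_ [E Hk]].
    assert (H : 1 < odd_sq (S k)) by nra.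
    apply is_series_ext with (fun i => / odd_sq (S k) ^ S N * ((a + b * INR i) * (/ odd_sq (S k)) ^ i)).
    + intros i; eqR; unfold F. rewrite pow_inv.
      replace (S (N + i)) with (S N + i)%nat by lia.
      rewrite pow_add, Rinv_mult; ring.
    + apply is_series_Rmult_l, is_series_arith_geom; split.
      * left; apply Rinv_0_lt_compat; lra.
      * rewrite <- Rinv_1. apply Rinv_lt_contravar; lra.
  - apply is_series_ext with (2 := is_series_plus _ _ _ _
      (is_series_Rmult_l (a / 4) _ _ H1) (is_series_Rmult_l (b / 16) _ _ H2)).
    intros k; cbv zeta. change plus with Rplus. eqR.
    destruct (odd_sq_succ k) as [Eq [E Hk]].
    rewrite pow_mult, <- Eq.
    assert (H : 1 < odd_sq (S k)) by nra.
    assert (HN : odd_sq (S k) ^ N <> 0) by (apply pow_nonzero; lra).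
    replace (/ odd_sq (S k) ^ S N * (a / (1 - / odd_sq (S k))
        + b * / odd_sq (S k) / (1 - / odd_sq (S k)) ^ 2))
      with (/ odd_sq (S k) ^ N * (a / (odd_sq (S k) - 1) + b / (odd_sq (S k) - 1) ^ 2))
      by (simpl (_ ^ S N); field; repeat split; lra).
    rewrite E. field. repeat split; lra.
Qed.

(** The series of [t sec^2 t - tan t] has terms [2 i tan_coef i t^(2 i + 1)]. After its first [N]
    terms are dropped, subtracting the closed form of the geometric series removes the [k = 0] term
    [1] from every [odd_zeta]. *)
Lemma is_series_remainder (N : nat) (t : R) :
  (1 <= N)%nat -> 0 < t < PI / 2 ->
  let x := (2 * t / PI) ^ 2 in
  is_series (fun i => 4 / t * x ^ S N * ((INR N + 1 * INR i) * x ^ i * odd_zeta_tail (N + i)))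
    (t / cos t ^ 2 - tan t
     - sumR (fun i => 2 * INR (S i) * (t * (tan_coef (S i) * (t ^ 2) ^ S i))) (N - 1)
     - 4 / t * x ^ S N * (INR N / (1 - x) + 1 * x / (1 - x) ^ 2)).
Proof.
  intros HN Ht x. assert (HP := PI_RGT_0).
  assert (Hx : 0 <= x < 1).
  { unfold x; split; [apply pow2_ge_0|].
    assert (0 < 2 * t / PI < 1).
    { split; [apply Rdiv_lt_0_compat; lra|].
      apply Rmult_lt_reg_r with PI; [lra|]. unfold Rdiv; rewrite Rmult_assoc, Rinv_l; lra. }
    nra. }
  set (u := fun i => 2 * INR i * (t * (tan_coef i * (t ^ 2) ^ i))).
  assert (Hu : is_series u (t / cos t ^ 2 - tan t)).
  { apply is_series_ext with (2 := is_series_minus _ _ _ _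
      (is_series_Rmult_l t _ _ (is_series_sec2_coef t ltac:(lra))) (is_series_tan t Ht)).
    intros i; unfold u, plus, opp; simpl. eqR; ring. }
  (* The term [u 0] is zero, so the first [N] terms reduce to the indices [1] to [N - 1]. *)
  assert (Hsum : sum_n u (pred N) = sumR (fun i => u (S i)) (N - 1)).
  { rewrite sum_n_sumR. destruct N as [|n]; [lia|]. simpl pred.
    replace (S n - 1)%nat with n by lia. clear.
    induction n as [|n IH]; [unfold u; simpl; ring|].
    change (sumR u (S n) + u (S n) = sumR (fun i => u (S i)) n + u (S n)).
    now rewrite IH. }
  assert (HuN : is_series (fun i => u (N + i)%nat)
     (t / cos t ^ 2 - tan t - sumR (fun i => u (S i)) (N - 1))).
  { apply (is_series_incr_n u N); [lia|].
    change (is_series u (t / cos t ^ 2 - tan t - sumR (fun i => u (S i)) (N - 1)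
                         + sum_n u (pred N))).
    rewrite Hsum. now replace (_ + _) with (t / cos t ^ 2 - tan t) by ring. }
  apply is_series_ext with (2 := is_series_minus _ _ _ _ HuN
    (is_series_Rmult_l (4 / t * x ^ S N) _ _ (is_series_arith_geom (INR N) 1 x Hx))).
  intros i; unfold plus, opp; simpl. eqR.
  unfold u, odd_zeta_tail, tan_coef.
  replace (2 * (N + i) + 2)%nat with (2 * (S N + i))%nat by lia.
  rewrite pow_mult.
  change (x * x ^ N) with (x ^ S N). change (t * (t * 1)) with (t ^ 2).
  replace (2 * INR (N + i) * (t * (2 * ((2 / PI) ^ 2) ^ (S N + i) * odd_zeta (N + i) * (t ^ 2) ^ (N + i))))
    with (4 / t * INR (N + i) * x ^ (S N + i) * odd_zeta (N + i)).
  - rewrite pow_add, plus_INR. ring.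
  - unfold x. replace (2 * t / PI) with (2 / PI * t) by (field; lra).
    rewrite !Rpow_mult_distr.
    change (S N + i)%nat with (S (N + i)). simpl (t ^ 2) at 1.
    rewrite <- (tech_pow_Rmult (t ^ 2)). field. lra.
Qed.

(** * Two-sided estimate of the remainder *)

Theorem theorem11 (B : nat -> R) (HB : is_bernoulli B)
  (N : nat) (HN : (1 <= N)%nat)
  (S1 S2 : R)
  (HS1 : infinite_sum
           (fun i => let k := INR (i + 2) in
              1 / ((2 * k - 1) ^ (2 * N) * k * (k - 1))) S1)
  (HS2 : infinite_sum
           (fun i => let k := INR (i + 2) in
              1 / ((2 * k - 1) ^ (2 * N) * k ^ 2 * (k - 1) ^ 2)) S2)
  (t : R) (Ht : 0 < t < PI / 2) :
  let n := INR N in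
  let L :=
    n * 2 ^ (2 * N + 4) * t ^ (2 * N + 1) / PI ^ (2 * N + 2) *
      ((2 ^ (2 * N + 2) - 1) * PI ^ (2 * N + 2) * Rabs (B (2 * N + 2)%nat)
         / (2 * INR (fact (2 * N + 2))) - 1)
    + 2 ^ (2 * N + 6) * t ^ (2 * N + 3) / PI ^ (2 * N + 4) *
      ((2 ^ (2 * N + 4) - 1) * PI ^ (2 * N + 4) * Rabs (B (2 * N + 4)%nat)
         / (2 * INR (fact (2 * N + 4))) - 1) in
  let E :=
    t / (cos t) ^ 2 - tan t
    - sumR (fun i => let j := S i in
              2 * INR j * 2 ^ (2 * j + 2) * (2 ^ (2 * j + 2) - 1)
              * Rabs (B (2 * j + 2)%nat) / INR (fact (2 * j + 2))
              * t ^ (2 * j + 1)) (N - 1)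
    - n * 2 ^ (2 * N + 4) * t ^ (2 * N + 1) / (PI ^ (2 * N) * (PI ^ 2 - 4 * t ^ 2))
    - 2 ^ (2 * N + 6) * t ^ (2 * N + 3) / (PI ^ (2 * N) * (PI ^ 2 - 4 * t ^ 2) ^ 2) in
  let M :=
    n * 2 ^ (2 * N + 2) * t ^ (2 * N + 1) / PI ^ (2 * N + 2) * S1
    + 2 ^ (2 * N + 2) * t ^ (2 * N + 3) / PI ^ (2 * N + 4) * S2 in
  L < E < M.
Proof.
  intros n L E M. assert (HP := PI_RGT_0).
  set (x := (2 * t / PI) ^ 2).
  set (c := 4 / t * x ^ S N).
  assert (Hy : 0 < 2 * t / PI < 1).
  { split; [apply Rdiv_lt_0_compat; lra|].
    apply Rmult_lt_reg_r with PI; [lra|]. unfold Rdiv; rewrite Rmult_assoc, Rinv_l; lra. }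
  assert (Hx : 0 < x < 1) by (unfold x; split; nra).
  assert (Hc : 0 < c).
  { apply Rmult_lt_0_compat; [apply Rdiv_lt_0_compat; lra|apply pow_lt; lra]. }
  assert (Hn : 1 <= n) by exact (le_INR 1 N HN).
  (* Powers of exponent [2 * N] are written as [N]-th powers of squares, which [field] can then
     treat as atoms. *)
  assert (EP : forall a, a ^ (2 * N) = (a ^ 2) ^ N) by (intros a; apply pow_mult).
  assert (HP0 : (PI ^ 2) ^ N <> 0) by (apply pow_nonzero; nra).
  assert (ExN : x ^ N = (2 ^ 2) ^ N * (t ^ 2) ^ N / (PI ^ 2) ^ N).
  { unfold x, Rdiv. rewrite !Rpow_mult_distr, <- !pow_inv, <- !pow_mult. reflexivity. }
  assert (Ec : c = 16 * t * ((2 ^ 2) ^ N * (t ^ 2) ^ N / (PI ^ 2) ^ N) / PI ^ 2).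
  { unfold c. rewrite <- ExN, <- tech_pow_Rmult. unfold x at 1. field. lra. }
  (* The braces of the lower bound are therefore [odd_zeta_tail N] and [odd_zeta_tail (S N)]. *)
  assert (EZ : forall i, 1 + odd_zeta_tail i =
    (2 ^ (2 * i + 2) - 1) * PI ^ (2 * i + 2) * Rabs (B (2 * i + 2)%nat)
         / (2 * INR (fact (2 * i + 2)))).
  { intros i. assert (H := tan_coef_bernoulli B i HB).
    unfold tan_coef in H. unfold odd_zeta_tail.
    replace (1 + (odd_zeta i - 1)) with (odd_zeta i) by ring.
    assert (H2 : 2 ^ (2 * i + 2) <> 0) by (apply pow_nonzero; lra).
    assert (H3 : PI ^ (2 * i + 2) <> 0) by (apply pow_nonzero; lra).
    assert (H4 := INR_fact_neq_0 (2 * i + 2)).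
    unfold Rdiv at 1 in H; rewrite Rpow_mult_distr, pow_inv in H.
    apply Rmult_eq_reg_l with (2 * (2 ^ (2 * i + 2) * / PI ^ (2 * i + 2))).
    - rewrite H. field. auto.
    - apply Rmult_integral_contrapositive_currified; [lra|].
      apply Rmult_integral_contrapositive_currified; [assumption|].
      now apply Rinv_neq_0_compat. }
  assert (EL : L = c * (n * odd_zeta_tail N + x * odd_zeta_tail (S N))).
  { assert (Z0 := EZ N). assert (Z1 := EZ (S N)).
    replace (2 * S N + 2)%nat with (2 * N + 4)%nat in Z1 by lia.
    unfold L. rewrite <- Z0, <- Z1, Ec, !pow_add, !EP. unfold x.
    generalize dependent ((PI ^ 2) ^ N); intros P HP0 _ _.
    field. lra. }
  assert (EE : E = t / cos t ^ 2 - tan t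
     - sumR (fun i => 2 * INR (S i) * (t * (tan_coef (S i) * (t ^ 2) ^ S i))) (N - 1)
     - c * (n / (1 - x) + 1 * x / (1 - x) ^ 2)).
  { unfold E. rewrite (sumR_ext _ (fun i => 2 * INR (S i) * (t * (tan_coef (S i) * (t ^ 2) ^ S i)))).
    - rewrite Ec, !pow_add, !EP. unfold x.
      assert (PI ^ 2 - 4 * t ^ 2 <> 0) by nra.
      assert (cos t <> 0) by (apply Rgt_not_eq, cos_gt_0; lra).
      generalize dependent ((PI ^ 2) ^ N); intros P HP0 _ _.
      field. repeat split; try lra; nra.
    - intros i _; cbv zeta. rewrite tan_coef_bernoulli with (1 := HB).
      rewrite (pow_add t), (pow_mult t 2). field. apply INR_fact_neq_0. }
  assert (EM : M = c * (n / 4 * S1 + x / 16 * S2)).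
  { unfold M. rewrite Ec, !pow_add, !EP. unfold x.
    generalize dependent ((PI ^ 2) ^ N); intros P HP0 _ _.
    field. lra. }
  assert (HE := is_series_remainder N t HN Ht). cbv zeta in HE.
  fold n x c in HE. rewrite <- EE in HE.
  set (u := fun i => c * ((n + 1 * INR i) * x ^ i * odd_zeta_tail (N + i))) in HE.
  clearbody L E M c x n.
  assert (Hpos : forall i, 0 <= x ^ i <= 1 /\ 0 < odd_zeta_tail (N + i) /\ 0 <= INR i).
  { intros i; repeat split; [apply pow_le; lra| |apply odd_zeta_tail_pos|apply pos_INR].
    rewrite <- (pow1 i); apply pow_incr; lra. }
  assert (HN1 := odd_zeta_tail_pos (S N)).
  assert (HN0 := odd_zeta_tail_pos N).
  split.
  (* The second term has weight [n + 1], of which [L] keeps only [1]; the excess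
     [c * (n * x * odd_zeta_tail (S N))] makes the inequality strict. *)
  - apply Rlt_le_trans with (sum_n u 1).
    + rewrite sum_Sn, sum_O; unfold plus, u; simpl.
      rewrite Nat.add_0_r, Nat.add_1_r, EL.
      assert (0 < c * (n * x * odd_zeta_tail (S N))) by (repeat apply Rmult_lt_0_compat; lra).
      nra.
    + apply sum_n_le_series; [|exact HE].
      intros i; unfold u; destruct (Hpos i) as [H1 [H2 H3]].
      repeat apply Rmult_le_pos; lra.
  - assert (HM := is_series_Rmult_l c _ _
      (is_series_weighted_tail N S1 S2 n x ltac:(lra) ltac:(lra) HS1 HS2)).
    rewrite <- EM in HM.
    assert (HD := is_series_minus _ _ _ _ HM HE).
    (* Termwise difference between the weights [n + x i] of [M] and [(n + i) x^i] of [E]. It is zero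
       at [i = 0], and its term [n * (1 - x)] at [i = 1] gives strictness. *)
    set (d := fun i => c * odd_zeta_tail (N + i) * (n * (1 - x ^ i) + INR i * (x - x ^ i))).
    assert (Hd : is_series d (M - E)).
    { apply is_series_ext with (2 := HD). intros i; unfold d, u, plus, opp; simpl. eqR; ring. }
    enough (0 < M - E) by lra.
    apply Rlt_le_trans with (sum_n d 1).
    + rewrite sum_Sn, sum_O; unfold plus, d; simpl. rewrite Nat.add_1_r.
      assert (0 < c * odd_zeta_tail (S N) * (n * (1 - x)))
        by (repeat apply Rmult_lt_0_compat; lra).
      nra.
    + apply sum_n_le_series; [|exact Hd].
      intros i; unfold d; destruct (Hpos i) as [H1 [H2 H3]].
      apply Rmult_le_pos; [apply Rmult_le_pos; lra|].
      apply Rplus_le_le_0_compat; [apply Rmult_le_pos; lra|].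
      (* At [i = 0] the factor [x - 1] is negative but has weight [0]; for larger indices the power
         is at most [x]. *)
      destruct i as [|i]; [simpl; lra|].
      destruct (Hpos i) as [H4 _]. apply Rmult_le_pos; [lra|].
      simpl; nra.
Qed.
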